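(* Assume that $\psi_i>0$ on $X$ for every $i\in I$, and that for all $i\ne j$ in $I$ and all $\alpha,\beta\in\mathbb R$ with $\alpha^2+\beta^2>0$, $$\mu\left(\{x\in X:\ \alpha\psi_i(x)+\beta\psi_j(x)=0\}\right)=0 .$$ Let $\vec m\in\partial S^{\psi}_I$ with $m_i>0$ for all $i\in I$. Then: (i) $\vec m$ is an exposed point of $S^{\psi}_I$, in the sense that $\vec m$ is not an interior point of any segment contained in $S^{\psi}_I$. (ii) There exists a unique element in $\mathcal P^{\psi,w}_{\vec m}$, and this weak partition is a strong one.
   Context: $X$ is a compact Polish space with Borel $\sigma$-algebra $\mathcal B$, $\mu$ is a non-atomic Borel probability measure on $X$, $I=\{1,\dots,N\}$, and $\psi_1,\dots,\psi_N:X\to\mathbb R$ are continuous. For $\vec m\in\mathbb R^N$, $\mathcal P^{\psi}_{\vec m}$ (strong partitions) is the set of $N$-tuples $(X_1,\dots,X_N)$ of sets in $\mathcal B$ with $\bigcup_i X_i=X$, $\mu(X_i\cap X_j)=0$ for $i\ne j$, and $\int_{X_i}\psi_i\,d\mu=m_i$ for all $i$. $S^{\psi}_I=\{\vec m\in\mathbb R^N:\mathcal P^{\psi}_{\vec m}\ne\emptyset\}$, and $\partial S^{\psi}_I$ is its boundary in $\mathbb R^N$. $\mathcal P^{\psi,w}_{\vec m}$ (weak partitions) is the set of $N$-tuples $\vec\mu=(\mu_1,\dots,\mu_N)$ of non-negative Borel measures on $X$ with $\sum_i\mu_i=\mu$ and $\int_X\psi_i\,d\mu_i=m_i$ for all $i$.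 A weak partition $\vec\mu$ is called strong if there is $(X_1,\dots,X_N)\in\mathcal P^{\psi}_{\vec m}$ such that $\mu_i=\mu\lfloor X_i$ (the restriction of $\mu$ to $X_i$) for all $i$. A segment is non-degenerate, i.e. has distinct endpoints. *)

(* Defs.v *)
From HB Require Import structures.
From mathcomp Require Import all_boot all_order all_algebra.
From mathcomp Require Import all_classical all_reals all_analysis.

Set Implicit Arguments.
Unset Strict Implicit.
Unset Printing Implicit Defensive.

Import Order.TTheory GRing.Theory Num.Theory.
Import numFieldNormedType.Exports.

Local Open Scope classical_set_scope.
Local Open Scope ring_scope.

(* A notation rather than a definition, so that the measurable structure of
   [g_sigma_algebraType] is found by inference.  The carrier is [X] itself. *)
Notation borel X := (g_sigma_algebraType (@open X)).

Definition is_metric (R : realType) (X : Type) (d : X -> X -> R) : Prop :=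
  [/\ forall x y, d x y = 0 <-> x = y,
      forall x y, d x y = d y x &
      forall x y z, d x z <= d x y + d y z].

Definition metric_complete (R : realType) (X : topologicalType)
    (d : X -> X -> R) : Prop :=
  forall u : nat -> X,
    (forall e : R, 0 < e -> exists n0 : nat, forall p q : nat,
       (n0 <= p)%N -> (n0 <= q)%N -> d (u p) (u q) < e) ->
    exists l : X, u @ \oo --> l.

Definition polish_space (R : realType) (X : topologicalType) : Prop :=
  (exists2 D : set X, countable D & dense D) /\
  exists d : X -> X -> R,
    [/\ is_metric d,
        forall x : X, nbhs x = nbhs_ball_ (fun y e => [set z | d y z < e]) x &
        metric_complete d].

Definition boundary (T : topologicalType) (A : set T) : set T :=
  closure A `\` interior A.

Definition nonatomic d (T : measurableType d) (R : realType)
    (mu : {measure set T -> \bar R}) : Prop :=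
  forall A, measurable A -> (0 < mu A)%E ->
    exists B, [/\ measurable B, B `<=` A, (0 < mu B)%E & (mu B < mu A)%E].

Definition segment (R : realType) (V : lmodType R) (a b : V) : set V :=
  [set (1 - t) *: a + t *: b | t in [set t : R | 0 <= t <= 1]].

Definition open_segment (R : realType) (V : lmodType R) (a b : V) : set V :=
  [set (1 - t) *: a + t *: b | t in [set t : R | 0 < t < 1]].

(* "Exposed" is meant here in the sense of an extreme point: no supporting
   hyperplane is involved. *)
Definition exposed_point (R : realType) (V : lmodType R) (S : set V) (m : V)
    : Prop :=
  S m /\ forall a b : V, a <> b -> segment a b `<=` S -> ~ open_segment a b m.

Section Partitions.
Variables (R : realType) (X : ptopologicalType) (N : nat).
Variables (mu : probability (borel X) R) (psi : 'I_N -> X -> R).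

Definition strong_partitions (m : 'rV[R]_N) : set ('I_N -> set (borel X)) :=
  [set A | [/\ forall i, measurable (A i),
               \bigcup_i A i = setT,
               forall i j, i != j -> mu (A i `&` A j) = 0%E &
               forall i, (\int[mu]_(x in A i) (psi i x)%:E)%E
                         = (m ord0 i)%:E]].

Definition strong_attainable : set 'rV[R]_N :=
  [set m | strong_partitions m !=set0].

Definition weak_partitions (m : 'rV[R]_N)
    : set ('I_N -> {measure set (borel X) -> \bar R}) :=
  [set nu | (forall B, measurable B -> (\sum_(i < N) nu i B)%E = mu B) /\
            forall i, (\int[nu i]_x (psi i x)%:E)%E = (m ord0 i)%:E].

Definition weak_is_strong (m : 'rV[R]_N)
    (nu : 'I_N -> {measure set (borel X) -> \bar R}) : Prop :=
  exists2 A, strong_partitions m A &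
    forall i B, measurable B -> nu i B = mu (B `&` A i).

End Partitions.

(* In the library a measure is a function on all subsets, whose values off the
   sigma-algebra carry no information; so two tuples of measures are
   identified when they agree on measurable sets. *)
Definition same_measures d (T : measurableType d) (R : realType) (N : nat)
    (nu nu' : 'I_N -> {measure set T -> \bar R}) : Prop :=
  forall i B, measurable B -> nu i B = nu' i B.

(* Main.v *)
Require Import Defs.
From HB Require Import structures.
From mathcomp Require Import all_boot all_order all_algebra.
From mathcomp Require Import all_classical all_reals all_analysis.
From mathcomp Require Import measurable_realfun.
From mathcomp Require Import ring lra.

Set Implicit Arguments.
Unset Strict Implicit.
Unset Printing Implicit Defensive.

Import Order.TTheory GRing.Theory Num.Theory.
Import numFieldNormedType.Exports.

Local Open Scope classical_set_scope.
Local Open Scope ring_scope.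

(** Call a tuple of measures with sum mu a splitting of mu; its moment vector
    collects the integrals of psi_i against the i-th measure.  The strong
    partitions are the splittings into restrictions of mu, and the attainable
    set S consists of their moment vectors.

    S is convex ([strong_attainable_convex]), because a Lyapunov argument
    lets one interpolate between two partitions exactly.  Hence a boundary
    point m has a nonzero supporting vector l: every s in S satisfies
    l.s <= l.m ([support_hyperplane]).

    Fix l.  The i-th cell is the set of points x where i is the first index
    maximizing l_i psi_i x.  The cells form a strong partition, and its moment
    vector, the optimum, maximizes l over all splittings: [deficitE] writes
    l.optimum - l.(moment nu) as the sum over i and j of the integrals of
    l_i psi_i - l_j psi_j >= 0 over the i-th cell against nu_j.  If moreover
    l_i psi_i = l_j psi_j only on a null part of the i-th cell, then a splitting
    with a small deficit gives this cell little nu_j-mass ([leak]).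

    Now m is a limit of attainable vectors, and l.optimum <= l.m, so strong
    partitions with moments tending to m have deficits whose limit is at most 0.
    This has two consequences.  First, if some l_j psi_j were beaten everywhere
    by some l_k psi_k, then j would never tie for the maximum, so that the j-th
    measure would leak out of every cell and m_j would be 0.  As psi > 0, this
    rules out that one coordinate of l vanishes while another one does not, so
    no coordinate of l vanishes.  Second, all ties are then null by the
    hypothesis on linear combinations, and so m is the optimum.

    Finally a splitting without deficit is the partition into cells up to null
    sets ([rigidity]).  This gives the uniqueness in (ii), with the cells as the
    strong partition.  It also gives (i): if m is interior to a segment of S,
    then l takes the value l.m at both ends, so both ends are the optimum. *)

(** * Separation and support of convex sets in R^N *)

Section Separation.
Variable R : realType.

Definition convex_subset (V : lmodType R) (S : set V) : Prop :=
  forall a b, S a -> S b -> segment a b `<=` S.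

Definition dot N (l x : 'rV[R]_N) : R := \sum_i l ord0 i * x ord0 i.

Lemma dotD N (l x y : 'rV[R]_N) : dot l (x + y) = dot l x + dot l y.
Proof. by rewrite -big_split/=; apply: eq_bigr => i _; rewrite mxE mulrDr. Qed.

Lemma dotZ N (l x : 'rV[R]_N) c : dot l (c *: x) = c * dot l x.
Proof. by rewrite mulr_sumr; apply: eq_bigr => i _; rewrite mxE mulrCA. Qed.

Lemma dotB N (l x y : 'rV[R]_N) : dot l (x - y) = dot l x - dot l y.
Proof. by rewrite dotD -scaleN1r dotZ mulN1r. Qed.

Lemma dotNl N (l x : 'rV[R]_N) : dot (- l) x = - dot l x.
Proof. by rewrite -sumrN; apply: eq_bigr => i _; rewrite mxE mulNr. Qed.

Lemma convex_subsetP (V : lmodType R) (S : set V) a b t :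
  convex_subset S -> S a -> S b -> 0 <= t <= 1 -> S ((1 - t) *: a + t *: b).
Proof. by move=> cS Sa Sb t01; apply: (cS a b) => //; exists t. Qed.

Definition tail N (x : 'rV[R]_N.+1) : 'rV[R]_N :=
  \row_j x ord0 (lift ord0 j).

Lemma tailD N (x y : 'rV[R]_N.+1) : tail (x + y) = tail x + tail y.
Proof. by apply/rowP => j; rewrite !mxE. Qed.

Lemma tailZ N c (x : 'rV[R]_N.+1) : tail (c *: x) = c *: tail x.
Proof. by apply/rowP => j; rewrite !mxE. Qed.

Definition prepend N c (l : 'rV[R]_N) : 'rV[R]_N.+1 :=
  \row_j (if unlift ord0 j is Some k then l ord0 k else c).

Lemma dot_prepend N c (l : 'rV[R]_N) x :
  dot (prepend c l) x = c * x ord0 ord0 + dot l (tail x).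
Proof.
rewrite /dot big_ord_recl; congr (_ + _).
  by rewrite mxE unlift_none.
by apply: eq_bigr => j _; rewrite !mxE liftK.
Qed.

(** By Fourier-Motzkin elimination: if C meets both sides of the hyperplane
    x_0 = 0, separate the slice of C in this hyperplane by some l and look for
    the missing coefficient c.  A point x of C on the positive side forces
    c >= - l.x / x_0 and a point y on the negative side forces
    c <= l.y / - y_0; these constraints are compatible because the segment
    from x to y crosses the slice. *)
Lemma separate_origin N (C : set 'rV[R]_N) :
  convex_subset C -> C !=set0 -> ~ C 0 ->
  exists2 l, l != 0 & forall x, C x -> 0 <= dot l x.
Proof.
elim: N C => [|N IH] C cC [x0 Cx0] C0.
  by exfalso; apply: C0; rewrite (_ : 0 = x0)//; apply/rowP => -[].
have one_sided c : c != 0 -> (forall x, C x -> 0 <= c * x ord0 ord0) ->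
    exists2 l : 'rV[R]_N.+1, l != 0 & forall x, C x -> 0 <= dot l x.
  move=> c0 Cc; exists (prepend c 0).
    by apply/eqP => /rowP/(_ ord0); rewrite !mxE unlift_none; exact/eqP.
  move=> x Cx; rewrite dot_prepend [dot 0 _]big1 ?addr0; first exact: Cc.
  by move=> i _; rewrite mxE mul0r.
have [[p Cp p0]|Cpos] := pselect (exists2 p, C p & 0 < p ord0 ord0); last first.
  apply: (one_sided (-1)); first by rewrite oppr_eq0 oner_neq0.
  move=> x Cx; rewrite mulN1r oppr_ge0 leNgt; apply/negP => x00.
  by apply: Cpos; exists x.
have [[q Cq q0]|Cneg] := pselect (exists2 q, C q & q ord0 ord0 < 0); last first.
  apply: (one_sided 1); first exact: oner_neq0.
  move=> x Cx; rewrite mul1r leNgt; apply/negP => x00.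
  by apply: Cneg; exists x.
pose C' := [set tail x | x in C `&` [set x | x ord0 ord0 = 0]].
(* the segment from x to y crosses the hyperplane at t = x_0 / (x_0 - y_0) *)
have cross x y : C x -> C y -> 0 < x ord0 ord0 -> y ord0 ord0 < 0 ->
    C' ((x ord0 ord0 - y ord0 ord0)^-1 *:
        (- y ord0 ord0 *: tail x + x ord0 ord0 *: tail y)).
  move=> Cx Cy x00 y00.
  have d0 : 0 < x ord0 ord0 - y ord0 ord0 by lra.
  set d := x ord0 ord0 - y ord0 ord0 in d0 *.
  pose t := d^-1 * x ord0 ord0.
  have t1 : 1 - t = d^-1 * - y ord0 ord0.
    by rewrite /t -(mulVf (lt0r_neq0 d0)) -mulrBr /d; congr (_ * _); ring.
  exists ((1 - t) *: x + t *: y).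
    split; last by rewrite /= !mxE t1 /t; ring.
    apply: convex_subsetP => //; apply/andP; split.
      by rewrite mulr_ge0 ?invr_ge0 ?ltW.
    by rewrite -subr_ge0 t1 mulr_ge0 ?invr_ge0 ?oppr_ge0 ?ltW.
  by rewrite tailD !tailZ t1 /t scalerDr !scalerA.
have cC' : convex_subset C'.
  move=> _ _ [x [Cx x00] <-] [y [Cy y00] <-] _ [t t01 <-].
  exists ((1 - t) *: x + t *: y); last by rewrite tailD !tailZ.
  split; first exact: convex_subsetP.
  by rewrite /= !mxE x00 y00 !mulr0 addr0.
have C'0 : ~ C' 0.
  move=> [x [Cx x00] tx0]; apply: C0; rewrite (_ : 0 = x)//.
  apply/rowP => i; rewrite mxE; case: (unliftP ord0 i) => [j ->|-> //].
  by move/rowP: tx0 => /(_ j); rewrite !mxE.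
have [l l0 lC'] := IH C' cC' (ex_intro _ _ (cross _ _ Cp Cq p0 q0)) C'0.
have slope x y : C x -> C y -> 0 < x ord0 ord0 -> y ord0 ord0 < 0 ->
    - dot l (tail x) / x ord0 ord0 <= dot l (tail y) / - y ord0 ord0.
  move=> Cx Cy x00 y00; have := lC' _ (cross _ _ Cx Cy x00 y00).
  have d0 : 0 < x ord0 ord0 - y ord0 ord0 by lra.
  rewrite dotZ pmulr_rge0 ?invr_gt0// dotD !dotZ => h.
  rewrite ler_pdivlMr ?oppr_gt0// mulrAC ler_pdivrMr//; lra.
pose E := [set - dot l (tail x) / x ord0 ord0 |
    x in C `&` [set x | 0 < x ord0 ord0]].
have Esup : has_sup E.
  split; first by exists (- dot l (tail p) / p ord0 ord0), p.
  exists (dot l (tail q) / - q ord0 ord0) => _ [x [Cx x00] <-]; exact: slope.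
exists (prepend (sup E) l).
  apply: contra l0 => /eqP/rowP l0; apply/eqP/rowP => j.
  by have := l0 (lift ord0 j); rewrite !mxE liftK.
move=> x Cx; rewrite dot_prepend.
have [x00|x00|x00] := ltgtP (x ord0 ord0) 0.
- have : sup E <= dot l (tail x) / - x ord0 ord0.
    apply: ge_sup; first by case: Esup.
    by move=> _ [y [Cy y00] <-]; exact: slope.
  rewrite ler_pdivlMr ?oppr_gt0//; lra.
- have : - dot l (tail x) / x ord0 ord0 <= sup E.
    by apply: sup_upper_bound => //; exists x.
  rewrite ler_pdivrMr//; lra.
- by rewrite x00 mulr0 add0r; apply: lC'; exists x.
Qed.

(** The share of weight kept for m lets the induction start at the empty family
    and makes each step a combination of two points of S. *)
Lemma convex_subset_mean (V : lmodType R) (S : set V) (m : V) I (r : seq I)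
    (v : I -> V) :
  convex_subset S -> S m -> (forall i, S (m + v i)) ->
  S (m + (size r).+1%:R^-1 *: \sum_(i <- r) v i).
Proof.
move=> cS Sm Sv; elim: r => [|i r IH]; first by rewrite big_nil scaler0 addr0.
rewrite big_cons /=; set k : R := (size r).+1%:R in IH *.
have k0 : 0 < k by rewrite ltr0n.
have -> : (size r).+2%:R = k + 1 by rewrite -natr1.
set s := \sum_(_ <- _) _ in IH *.
have k1 : k + 1 != 0 by lra.
have e : 1 - (k + 1)^-1 = (k + 1)^-1 * k by field.
have -> : m + (k + 1)^-1 *: (v i + s) =
    (1 - (k + 1)^-1) *: (m + k^-1 *: s) + (k + 1)^-1 *: (m + v i).
  rewrite !scalerDr scalerA {2}e mulfK ?gt_eqF// scalerBl scale1r.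
  by rewrite addrACA subrK [_ *: s + _]addrC.
apply: convex_subsetP => //.
by rewrite invr_ge0 (ltW (ltr_wpDr _ _))//= invf_le1; lra.
Qed.

(** For m outside S this is [separate_origin].  For m in S, let K be the cone of
    directions in which one can leave m inside S.  If K were everything, S would
    contain a cross-polytope centred at m and m would be interior.  A vector
    outside K is separated from K, and on a cone the separating functional
    is nonnegative. *)
Lemma support_hyperplane N (S : set 'rV[R]_N) m :
  convex_subset S -> S !=set0 -> ~ interior S m ->
  exists2 l, l != 0 & forall s, S s -> dot l s <= dot l m.
Proof.
move=> cS S0 Sm.
suff [l l0 lS] : exists2 l, l != 0 & forall s, S s -> 0 <= dot l (s - m).
  exists (- l); first by rewrite oppr_eq0.
  by move=> s /lS; rewrite dotB !dotNl; lra.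
have [mS|nS] := pselect (S m); last first.
  have [|||l l0 lC] := @separate_origin N [set x | S (x + m)].
  - move=> a b Sa Sb _ [t t01 <-] /=.
    rewrite (_ : _ + m = (1 - t) *: (a + m) + t *: (b + m)).
      exact: convex_subsetP.
    by rewrite !scalerDr addrACA -scalerDl subrK scale1r.
  - by case: S0 => s Ss; exists (s - m); rewrite /= subrK.
  - by rewrite /= add0r.
  by exists l => // s Ss; apply: lC; rewrite /= subrK.
pose K := [set x | exists2 t, 0 < t & S (m + t *: x)].
have shrink x t r : S (m + t *: x) -> 0 <= r <= t -> S (m + r *: x).
  move=> Stx /andP[r0 rt].
  have [t0|t0] := ltP 0 t; last first.
    have -> : r = t by lra.
    by [].
  rewrite (_ : m + _ = (1 - r / t) *: m + (r / t) *: (m + t *: x)).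
    apply: convex_subsetP => //.
    by rewrite divr_ge0 ?ler_pdivrMr ?mul1r ?(ltW t0).
  rewrite scalerDr addrA -scalerDl subrK scale1r scalerA divfK//.
  exact: lt0r_neq0.
have cK : convex_subset K.
  move=> x y [t t0 Sx] [s s0 Sy] _ [c c01 <-].
  exists (Num.min t s); first by rewrite lt_min t0.
  set r := Num.min t s.
  have r0 : 0 <= r by rewrite le_min !ltW.
  have Sx' : S (m + r *: x) by apply: shrink Sx _; rewrite r0 ge_min lexx.
  have Sy' : S (m + r *: y).
    by apply: shrink Sy _; rewrite r0 ge_min lexx orbT.
  rewrite (_ : m + _ = (1 - c) *: (m + r *: x) + c *: (m + r *: y)).
    exact: convex_subsetP.
  rewrite !scalerDr !scalerA addrACA -scalerDl subrK scale1r.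
  by rewrite ![c * r]mulrC ![(1 - c) * r]mulrC.
have [x Kx] : exists x, ~ K x.
  apply: contrapT => /forallNP Kfull; apply: Sm.
  (* one step length along each of the 2N signed axes, then their minimum *)
  have /choice[T HT] (ib : 'I_N * bool) : exists t, 0 < t /\
      S (m + t *: ((-1) ^+ ib.2 *: delta_mx ord0 ib.1)).
    by have /contrapT[t ? ?] := Kfull ((-1) ^+ ib.2 *: delta_mx ord0 ib.1);
      exists t.
  pose t := \big[Num.min/1]_ib T ib.
  have t0 : 0 < t.
    rewrite /t; elim/big_ind: _ => // [a b a0 b0|ib _].
      by rewrite lt_min a0.
    by case: (HT ib).
  have axis i c : `|c| <= t -> S (m + c *: delta_mx ord0 i).
    move=> ct; case: (HT (i, c < 0)) => _ /= /shrink H; move: (H `|c|).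
    rewrite scalerA normr_ge0 /= mulrC -realEsign ?num_real//.
    by apply; apply: le_trans ct _; exact: bigmin_le_cond.
  apply/nbhs_ballP; exists (t / N.+1%:R) => /=; first by rewrite divr_gt0.
  move=> z [_ zm]; pose v i : 'rV[R]_N :=
    (N.+1%:R * (z - m) ord0 i) *: delta_mx ord0 i.
  have vS i : S (m + v i).
    apply: axis; have := zm ord0 i; rewrite /ball /= => h.
    rewrite normrM normr_nat mulrC -ler_pdivlMr ?ltr0n//.
    by rewrite ltW//; move: h; rewrite distrC !mxE.
  have := @convex_subset_mean _ S m 'I_N (index_enum 'I_N) v cS mS vS.
  suff -> : m + (size (index_enum 'I_N)).+1%:R^-1 *:
    \sum_(i <- index_enum 'I_N) v i = z by [].
  have -> : size (index_enum 'I_N) = N by rewrite -[RHS]card_ord cardT enumT.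
  rewrite /v; under eq_bigr do rewrite -scalerA.
  rewrite -scaler_sumr scalerA mulVf ?pnatr_eq0// scale1r.
  by rewrite -row_sum_delta addrC subrK.
have [|||l l0 lC] := @separate_origin N [set k | K (k + x)].
- move=> a b Sa Sb _ [t t01 <-] /=.
  rewrite (_ : _ + x = (1 - t) *: (a + x) + t *: (b + x)).
    exact: convex_subsetP.
  by rewrite !scalerDr addrACA -scalerDl subrK scale1r.
- by exists (- x), 1 => //; rewrite addNr scaler0 addr0.
- by rewrite /= add0r.
exists l => // s Ss; rewrite leNgt; apply/negP => ls.
(* a multiple of s - m that lies too far on the negative side *)
pose c := 1 + `|dot l x| / - dot l (s - m).
have c1 : 1 <= c by rewrite lerDl divr_ge0// oppr_ge0 ltW.
have c0 : 0 < c by lra.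
have /lC : [set k | K (k + x)] (c *: (s - m) - x).
  exists c^-1; first by rewrite invr_gt0.
  by rewrite subrK scalerA mulVf ?gt_eqF// scale1r addrC subrK.
rewrite dotB dotZ /c mulrDl mul1r.
rewrite invrN mulrN mulNr divfK ?lt_eqF//.
by have := ler_norm (- dot l x); rewrite normrN; lra.
Qed.

End Separation.

(** * Measurability of comparisons *)

Section MeasurableComparisons.
Context d (T : measurableType d) (R : realType).

Lemma measurable_lt_set (f g : T -> R) : measurable_fun setT f ->
  measurable_fun setT g -> measurable [set x | f x < g x].
Proof.
move=> mf mg; have mgf : measurable_fun setT (g \- f) by exact: measurable_funB.
rewrite (_ : [set x | _] = setT `&` (g \- f) @^-1` `]0, +oo[).
  exact: (mgf measurableT _ (measurable_itv _)).
by rewrite setTI; apply/seteqP; split => x /=; rewrite in_itv /= andbT subr_gt0.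
Qed.

Lemma measurable_le_set (f g : T -> R) : measurable_fun setT f ->
  measurable_fun setT g -> measurable [set x | f x <= g x].
Proof.
move=> mf mg; rewrite (_ : [set x | _] = ~` [set x | g x < f x]).
  by apply: measurableC; exact: measurable_lt_set.
by apply/seteqP; split => x /=; rewrite leNgt => /negP.
Qed.

Lemma measurable_eq_set (f g : T -> R) : measurable_fun setT f ->
  measurable_fun setT g -> measurable [set x | f x = g x].
Proof.
move=> mf mg.
rewrite (_ : [set x | _] = [set x | f x <= g x] `&` [set x | g x <= f x]).
  by apply: measurableI; exact: measurable_le_set.
apply/seteqP; split => x /= => [->//|[fg gf]].
by apply/eqP; rewrite eq_le fg.
Qed.

End MeasurableComparisons.

(** * Lyapunov's convexity theorem *)

Section Lyapunov.
Context d (T : measurableType d) (R : realType).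
Implicit Types (A B : set T) (u : set T -> R).

Definition finitely_additive u : Prop :=
  (forall A, measurable A -> 0 <= u A) /\
  forall A B, measurable A -> measurable B -> A `&` B = set0 ->
    u (A `|` B) = u A + u B.

Lemma fadd0 u : finitely_additive u -> u set0 = 0.
Proof.
move=> [_ /(_ _ _ measurable0 measurable0 (set0I _))]; rewrite setU0; lra.
Qed.

Lemma fadd_setD u A B : finitely_additive u -> measurable A -> measurable B ->
  A `<=` B -> u (B `\` A) = u B - u A.
Proof.
move=> [_ uD] mA mB AB; have : u (A `|` (B `\` A)) = u A + u (B `\` A).
  by apply: uD => //; [exact: measurableD|
    rewrite setIDA setDE setIAC setICr set0I].
by rewrite setDUK//; lra.
Qed.

Lemma fadd_le u A B : finitely_additive u -> measurable A -> measurable B ->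
  A `<=` B -> u A <= u B.
Proof.
move=> uf mA mB AB; rewrite -subr_ge0 -fadd_setD//.
by apply: uf.1; exact: measurableD.
Qed.

Section Splitting.
Variables (v : nat -> set T -> R).
Hypothesis vf : forall i, finitely_additive (v i).

Definition halvable n : Prop := forall A, measurable A ->
  exists B, [/\ measurable B, B `<=` A &
    forall i, (i < n)%N -> v i B = v i A / 2].

Definition chainable n : Prop := forall A, measurable A ->
  exists B : R -> set T,
    [/\ forall t, measurable (B t), forall t, B t `<=` A,
        forall s t, s <= t -> B s `<=` B t &
        forall t i, 0 <= t <= 1 -> (i < n)%N -> v i (B t) = t * v i A].

Section Dyadic.
Variables (n : nat) (H : set T -> set T) (A : set T).
Hypothesis mA : measurable A.
Hypothesis HP : forall B, measurable B -> [/\ measurable (H B), H B `<=` B &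
  forall i, (i < n)%N -> v i (H B) = v i B / 2].

(** [dyadic k j] is the part of [A] up to the fraction j / 2^k: a new point of
    level k+1 is inserted by halving the difference of its two neighbours. *)
Fixpoint dyadic k j : set T :=
  if k is k'.+1 then
    if odd j then dyadic k' j./2 `|` H (dyadic k' j./2.+1 `\` dyadic k' j./2)
    else dyadic k' j./2
  else if j is 0%N then set0 else A.

Lemma dyadicS k : (forall j, measurable (dyadic k j)) /\
  (forall j, dyadic k j `<=` dyadic k j.+1).
Proof.
elim: k => [|k [mD DS]].
  by split=> -[|j] //=; exact: measurable0.
split=> j /=.
  case: ifP => // _; apply: measurableU => //.
  by case: (HP (measurableD (mD j./2.+1) (mD j./2))).
rewrite uphalf_half; case: ifP => /= oj; last by rewrite add0n; exact: subsetUl.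
rewrite add1n subUset; split; first exact: DS.
have [_ + _] := HP (measurableD (mD j./2.+1) (mD j./2)).
by move=> /subset_trans; apply; exact: subDsetl.
Qed.

Lemma measurable_dyadic k j : measurable (dyadic k j).
Proof. exact: (dyadicS k).1. Qed.

Lemma dyadic_homo k i j : (i <= j)%N -> dyadic k i `<=` dyadic k j.
Proof.
move=> /subnK <-; elim: (j - i)%N => // l IH.
by apply: subset_trans IH _; rewrite addSn; exact: (dyadicS k).2.
Qed.

Lemma dyadic_sub k j : dyadic k j `<=` A.
Proof.
elim: k j => [[|j]|k IH j] //=.
case: ifP => // _; rewrite subUset; split => //.
have mD := measurable_dyadic k.
have [_ + _] := HP (measurableD (mD j./2.+1) (mD j./2)).
by move=> /subset_trans; apply; exact: subset_trans (@subDsetl _ _ _) (IH _).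
Qed.

Lemma dyadic_refine k l j : dyadic (l + k) (2 ^ l * j) = dyadic k j.
Proof.
elim: l => [|l IH]; first by rewrite expn0 mul1n.
by rewrite addSn /= expnS -mulnA mul2n odd_double doubleK.
Qed.

Lemma dyadic_value i k j : (i < n)%N -> (j <= 2 ^ k)%N ->
  v i (dyadic k j) = j%:R / 2 ^+ k * v i A.
Proof.
move=> ilt; elim: k j => [|k IH] j jk.
  case: j jk => [|[|//]] _ /=; first by rewrite fadd0// !mul0r.
  by rewrite expr0 divr1 mul1r.
have je : j%:R = (odd j)%:R + 2 * (j./2)%:R :> R.
  by rewrite -{1}(odd_double_half j) natrD -mul2n natrM.
have hjk : (j./2 <= 2 ^ k)%N.
  rewrite -(leq_pmul2l (isT : (0 < 2)%N)) -expnS mul2n; apply: leq_trans jk.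
  by rewrite -[leqRHS]odd_double_half leq_addl.
rewrite /= je exprS; case: ifP => oj; last first.
  by rewrite IH// add0r invfM mulrACA divff ?mul1r// pnatr_eq0.
have hjk1 : (j./2.+1 <= 2 ^ k)%N.
  rewrite ltnNge; apply/negP => h.
  have /eqP e : j./2 == (2 ^ k)%N by rewrite eqn_leq hjk h.
  by move: jk; rewrite -(odd_double_half j) oj e expnS mul2n add1n ltnn.
have mD := measurable_dyadic k.
have DS := (dyadicS k).2 j./2.
have [mH HD Hv] := HP (measurableD (mD j./2.+1) (mD j./2)).
rewrite (vf i).2//.
  rewrite Hv// fadd_setD// !IH// -[j./2.+1%:R]natr1 mulr1n.
  have : (2 : R) ^+ k != 0 by rewrite expf_neq0.
  by move=> ?; field.
by apply/seteqP; split => // x [xD /HD[]].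
Qed.

End Dyadic.

Lemma half_expn_eps (e : R) : 0 < e -> exists k, (2 ^+ k)^-1 < e.
Proof.
move=> e0; exists (Num.truncn e^-1).+1.
rewrite invf_plt ?posrE ?exprn_gt0//.
apply: lt_trans (truncnS_gt _) _.
by rewrite -natrX ltr_nat; exact: ltn_expl.
Qed.

(** The chain at t is the union of all the dyadic pieces below t.  At each
    level it lies between two consecutive pieces, so finite additivity alone
    determines its value. *)
Lemma halvable_chainable n : halvable n -> chainable n.
Proof.
move=> hn A mA.
have /choice[H HP] (B : set T) : exists B', measurable B ->
    [/\ measurable B', B' `<=` B & forall i, (i < n)%N -> v i B' = v i B / 2].
  by have [/hn[B' ?]|nB] := pselect (measurable B); [exists B'|exists set0].
pose D := dyadic H A.
have mD k j : measurable (D k j) by exact: (measurable_dyadic mA HP).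
have DA k j : D k j `<=` A by exact: (dyadic_sub mA HP).
have Dh k i j : (i <= j)%N -> D k i `<=` D k j by exact: (dyadic_homo mA HP).
(* the last dyadic index below t at level k *)
pose q (t : R) k := Num.truncn (t * 2 ^+ k).
pose B t := \bigcup_k D k (q t k).
have mB t : measurable (B t) by exact: bigcupT_measurable.
have BA t : B t `<=` A by move=> x [k _ /DA].
exists B; split => // [s t st|t i /andP[t0 t1] ilt].
  apply: subset_bigcup => k _; apply: Dh; apply: le_truncn.
  by rewrite ler_pM2r// exprn_gt0.
have tk0 k : 0 <= t * 2 ^+ k by rewrite mulr_ge0// exprn_ge0.
have up k : B t `<=` D k (q t k).+1.
  move=> x [l _]; have [lk|kl] := leqP l k.
    rewrite -[D l _](@dyadic_refine H A l (k - l)) subnK//.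
    apply: Dh; apply: leqW; rewrite truncn_ge_nat// natrM natrX.
    have -> : t * 2 ^+ k = 2 ^+ (k - l) * (t * 2 ^+ l).
      by rewrite mulrCA -exprD subnK.
    by rewrite ler_pM2l ?exprn_gt0// truncn_le.
  rewrite -[D k _](@dyadic_refine H A k (l - k)) subnK 1?ltnW//.
  apply: Dh; apply: ltnW; rewrite truncn_lt_nat// natrM natrX.
  have -> : t * 2 ^+ l = 2 ^+ (l - k) * (t * 2 ^+ k).
    by rewrite mulrCA -exprD subnK// ltnW.
  by rewrite ltr_pM2l ?exprn_gt0// truncnS_gt.
have vA0 : 0 <= v i A by exact: (vf i).1.
have close k : `|v i (B t) - t * v i A| <= (2 ^+ k)^-1 * v i A.
  have k2 : (0 : R) < 2 ^+ k by rewrite exprn_gt0.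
  have qt : (q t k)%:R <= t * 2 ^+ k by rewrite truncn_le.
  have tq : t * 2 ^+ k < (q t k).+1%:R by exact: truncnS_gt.
  have lo : (q t k)%:R / 2 ^+ k * v i A <= v i (B t).
    rewrite -(@dyadic_value n H A mA HP)//; last first.
      rewrite -(ler_nat R) natrX; apply: le_trans qt _.
      by rewrite ler_piMl// ltW.
    by apply: fadd_le (vf i) (mD _ _) (mB t) _ => x Dx; exists k.
  have hi : v i (B t) <= (q t k).+1%:R / 2 ^+ k * v i A.
    have [qk|qk] := leqP (q t k).+1 (2 ^ k).
      rewrite -(@dyadic_value n H A mA HP)//.
      exact: fadd_le (vf i) (mB t) (mD _ _) (up k).
    apply: le_trans (fadd_le (vf i) (mB t) mA (BA t)) _.
    rewrite ler_peMl// ler_pdivlMr// mul1r -natrX ler_nat.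
    exact: ltnW.
  have qt' : (q t k)%:R / 2 ^+ k <= t by rewrite ler_pdivrMr.
  have tq' : t <= (q t k)%:R / 2 ^+ k + (2 ^+ k)^-1.
    by rewrite -[X in _ + X]mul1r -mulrDl natr1 ler_pdivlMr// ltW.
  move: hi; rewrite -natr1 mulrDl mul1r mulrDl => hi.
  set a := _ / _ in lo hi qt' tq'; set b := _^-1 in hi tq' *.
  have := ler_wpM2r vA0 qt'; have := ler_wpM2r vA0 tq'.
  rewrite mulrDl ler_norml; lra.
apply/eqP; rewrite -subr_eq0 -normr_le0 leNgt; apply/negP => e0.
have vA1 : 0 < v i A + 1 by lra.
have [k] := half_expn_eps (divr_gt0 e0 vA1).
have k2 : (0 : R) < (2 ^+ k)^-1 by rewrite invr_gt0 exprn_gt0.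
rewrite ltr_pdivlMr// => he; have := close k; move: he.
by rewrite mulrDr mulr1; lra.
Qed.

Lemma lipschitz_continuous (f : R -> R) L :
  (forall s t, s <= t -> `|f t - f s| <= L * (t - s)) -> continuous f.
Proof.
move=> fL x; apply/cvgrPdist_lt => /= e e0.
have L1 : 0 < `|L| + 1 by rewrite ltr_wpDl.
near=> y.
have xy : `|x - y| < e / (`|L| + 1).
  near: y; apply: (@cvgr_dist_lt _ _ _ (nbhs x) _ id x); first exact: cvg_id.
  exact: divr_gt0.
have : `|f x - f y| <= (`|L| + 1) * `|x - y|.
  have h s t : s <= t -> `|f t - f s| <= (`|L| + 1) * `|t - s|.
    move=> st; apply: le_trans (fL _ _ st) _.
    rewrite [`|t - s|]ger0_norm ?subr_ge0// ler_wpM2r ?subr_ge0//.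
    by apply: le_trans (ler_norm _) _; rewrite lerDl.
  have [|yx] := leP x y; last exact/h/ltW.
  by rewrite distrC [`|x - y|]distrC; exact: h.
by move=> /le_lt_trans; apply; rewrite mulrC -ltr_pdivlMr.
Unshelve. all: by end_near. Qed.

(** One more set function: slide a window of length 1/2 along a chain [B] that
    interpolates the first n of them.  Each window halves those, and the value
    of [v n] on the windows varies continuously, while the two extreme windows
    together give [v n A].  Some window therefore halves [v n] too. *)
Lemma chainable_halvable n M : (0 < n)%N ->
  (forall A, measurable A -> v n A <= M * v 0 A) ->
  chainable n -> halvable n.+1.
Proof.
move=> n0 vM cn A mA; have [B [mB BA Bh Bv]] := cn A mA.
pose clamp (t : R) := Num.min 1 (Num.max 0 t).
have clamp01 t : 0 <= clamp t <= 1.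
  by rewrite le_min ler01 /= le_max lexx /= ge_min lexx.
have clampE t : 0 <= t <= 1 -> clamp t = t.
  by move=> /andP[t0 t1]; rewrite /clamp (max_r t0) (min_r t1).
have clamp_le s t : s <= t -> 0 <= clamp t - clamp s <= t - s.
  rewrite /clamp !minEle !maxEle.
  by do ![case: ifP => [|/negbT]; rewrite -?ltNge]; lra.
pose G t := v n (B (clamp t)).
have GL s t : s <= t -> `|G t - G s| <= M * v 0 A * (t - s).
  move=> st; have /andP[c0 c1] := clamp_le _ _ st.
  have Bst : B (clamp s) `<=` B (clamp t) by apply: Bh; lra.
  rewrite /G -fadd_setD// ger0_norm; last first.
    by apply: (vf n).1; exact: measurableD.
  apply: le_trans (vM _ (measurableD (mB _) (mB _))) _.
  rewrite fadd_setD// !Bv// -mulrBl mulrCA [leRHS]mulrC ler_wpM2r//.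
  by apply: le_trans (vM A mA); exact: (vf n).1.
(* clamping makes G continuous on the whole line *)
have cG : continuous G := lipschitz_continuous GL.
pose F t := G (t + 2^-1) - G t.
have cF : {within `[0, 2^-1], continuous F}.
  apply: continuous_subspaceT => t; apply: cvgB; last exact: cG.
  apply: (@cvg_comp _ _ _ (fun t => t + 2^-1) G _ (nbhs (t + 2^-1)));
    last exact: cG.
  by apply: cvgD; [exact: cvg_id|exact: cvg_cst].
have G0 : G 0 = 0.
  apply/eqP; rewrite eq_le (vf n).1// andbT /G clampE ?lexx ?ler01//.
  by rewrite (le_trans (vM _ _))// Bv ?lexx ?ler01// mul0r mulr0.
have G1 : G 1 = v n A.
  rewrite /G clampE ?lexx ?ler01//; apply/eqP.
  rewrite eq_sym -subr_eq0 -fadd_setD//.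
  rewrite eq_le (vf n).1 ?andbT; last exact: measurableD.
  rewrite (le_trans (vM _ (measurableD mA (mB _))))// fadd_setD//.
  by rewrite Bv ?lexx ?ler01// mul1r subrr mulr0.
have Fsum : F 0 + F 2^-1 = v n A.
  by rewrite /F add0r G0 [2^-1 + _](_ : _ = 1) ?G1; [ring|field].
have [||t t01 Ft] := IVT (v := v n A / 2) _ cF.
- by rewrite invr_ge0.
- move: Fsum; set a := F 0; set b := F _ => h.
  rewrite ge_min le_max.
  case: (leP a b) => ab; apply/andP; split; apply/orP.
  + by left; lra.
  + by right; lra.
  + by right; lra.
  + by left; lra.
move: t01; rewrite in_itv /= => /andP[t0 t1].
exists (B (t + 2^-1) `\` B t); split; first exact: measurableD.
  by apply: subset_trans (@subDsetl _ _ _) (BA _).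
have Bt : B t `<=` B (t + 2^-1) by apply: Bh; lra.
move=> i; rewrite ltnS leq_eqVlt => /predU1P[->|ilt].
  by rewrite fadd_setD// -Ft /F /G !clampE//; lra.
by rewrite fadd_setD// !Bv//; lra.
Qed.

(** Lyapunov's theorem in the form of a chain that interpolates the set linearly
    for all the set functions at once.  They are dominated by [v 0], so it is
    enough that [v 0] alone can be halved. *)
Lemma lyapunov n M :
  (forall i A, measurable A -> v i A <= M * v 0 A) ->
  halvable 1 -> chainable n.+1.
Proof.
move=> vM h1; elim: n => [|n IH]; first exact: halvable_chainable.
apply: halvable_chainable; apply: chainable_halvable IH => //; exact: vM.
Qed.

End Splitting.

(** The sublevel sets of [g] have measures that increase from 0 to the whole;
    null level sets exclude jumps, so some sublevel set has half of the
    measure. *)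
Lemma halve_level_sets (mu : {finite_measure set T -> \bar R})
    (g : T -> R) K A :
  measurable_fun setT g -> (forall x, `|g x| <= K) ->
  (forall c, mu [set x | g x = c] = 0%E) -> measurable A ->
  exists B, [/\ measurable B, B `<=` A & fine (mu B) = fine (mu A) / 2].
Proof.
move=> mg gK g0 mA.
have muE B : measurable B -> mu B = (fine (mu B))%:E.
  by move=> mB; rewrite fineK//; exact: fin_num_measure.
pose L c := A `&` [set x | g x <= c].
have mLe c : measurable [set x | g x <= c] by exact: measurable_le_set.
have mLt c : measurable [set x | g x < c] by exact: measurable_lt_set.
have mL c : measurable (L c) by exact: measurableI.
pose F c := fine (mu (L c)).
have Fle c c' : c <= c' -> F c <= F c'.
  move=> cc'; rewrite fine_le ?fin_num_measure//.
  apply: le_measure; rewrite ?inE//; apply: setIS => x /= /le_trans; exact.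
have [A0|A0] := eqVneq (fine (mu A)) 0.
  by exists set0; split => //; rewrite A0 measure0 mul0r.
have {}A0 : 0 < fine (mu A) by rewrite lt_neqAle eq_sym A0 fine_ge0.
set h := fine (mu A) / 2; have h0 : 0 < h by rewrite divr_gt0.
pose E := [set c | F c <= h].
have EK : ubound E K.
  move=> c Ec; rewrite leNgt; apply/negP => Kc.
  have : F c <= h by [].
  have -> : F c = fine (mu A); last by rewrite /h; lra.
  congr (fine (mu _)); apply/setIidPl => x _ /=.
  by apply: le_trans (ltW Kc); apply: le_trans (gK x); exact: ler_norm.
have E0 : E !=set0.
  exists (- K - 1); rewrite /E /= /F /L (_ : A `&` _ = set0).
    by rewrite measure0 ltW.
  apply/seteqP; split => // x [_ /=]; rewrite leNgt => /negP; apply.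
  by have := gK x; rewrite ler_norml; lra.
have Esup : has_sup E by split => //; exists K.
pose c := sup E.
exists (L c); split; [exact: mL|exact: subIsetl|].
apply/eqP; rewrite eq_le; apply/andP; split.
  (* from below: the level set of c is null, so [g <= c] may become [g < c] *)
  pose U n := A `&` [set x | g x <= c - n.+1%:R^-1].
  have cvgU : mu \o U @ \oo --> mu (\bigcup_n U n).
    apply: nondecreasing_cvg_mu => // [||n m nm].
    - by move=> n; exact: mL.
    - by apply: bigcupT_measurable => n; exact: mL.
    - apply/subsetPset; apply: setIS => x /= /le_trans; apply.
      by rewrite lerD2l lerN2 lef_pV2 ?posrE// ler_nat.
  have UE : \bigcup_n U n = A `&` [set x | g x < c].
    rewrite -setI_bigcupr; congr (_ `&` _); apply/seteqP; split => x /=.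
      move=> [n _ /=] /le_lt_trans; apply.
      by rewrite ltrBlDr ltrDl.
    rewrite -subr_gt0 => /ltr_add_invr[n]; rewrite add0r => hn.
    by exists n => //=; rewrite lerBrDr -lerBrDl ltW.
  have : (mu (A `&` [set x | (g x < c)%R]) <= h%:E)%E.
    rewrite -UE; apply: (cvge_to_le cvgU); apply: nearW => n /=.
    have [y Ey cy] : exists2 y, E y & c - n.+1%:R^-1 < y by exact: sup_adherent.
    rewrite muE ?lee_fin; last exact: mL.
    by apply: le_trans Ey; apply: Fle; exact: ltW.
  rewrite muE; last exact: measurableI.
  rewrite lee_fin; apply: le_trans.
  have LE : L c = (A `&` [set x | g x < c]) `|` (A `&` [set x | g x = c]).
    rewrite -setIUr; congr (_ `&` _); apply/seteqP; split => x /=.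
      by rewrite le_eqVlt => /predU1P[|]; [right|left].
    by move=> [/ltW|->].
  have mE : measurable [set x | g x = c] by exact: measurable_eq_set.
  rewrite fine_le ?fin_num_measure//; first exact: measurableI.
  rewrite LE.
  apply: le_trans (measureU2 _ _ _) _; [exact: measurableI..|].
  rewrite -[leRHS]adde0 leeD2l// -(g0 c).
  by apply: le_measure; rewrite ?inE//; exact: measurableI.
pose U n := A `&` [set x | g x <= c + n.+1%:R^-1].
have UE : \bigcap_n U n = L c.
  apply/seteqP; split => x /=.
    move=> Ux; split; first by case: (Ux 0%N I).
    rewrite /= leNgt; apply/negP; rewrite -subr_gt0 => /ltr_add_invr[n].
    by rewrite add0r => hn; have [_ /=] := Ux n I; rewrite leNgt -ltrBrDl hn.
  move=> [Ax /= gc] n _; split => //=; apply: le_trans gc _.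
  by rewrite lerDl.
have cvgU : mu \o U @ \oo --> mu (\bigcap_n U n).
  apply: nonincreasing_cvg_mu => [||| n m nm].
  - by rewrite ltey_eq fin_num_measure//; exact: mL.
  - by move=> n; exact: mL.
  - by rewrite UE.
  - apply/subsetPset; apply: setIS => x /= /le_trans; apply.
    by rewrite lerD2l lef_pV2 ?posrE// ler_nat.
rewrite UE in cvgU.
rewrite -lee_fin -muE//; apply: (cvge_to_ge cvgU); apply: nearW => n /=.
rewrite muE ?lee_fin; last exact: mL.
rewrite leNgt; apply/negP => /ltW Un.
have : c + n.+1%:R^-1 <= c by apply: sup_upper_bound.
by rewrite leNgt ltrDl invr_gt0 ltr0Sn.
Qed.

End Lyapunov.

(** * Splittings of a finite measure *)

Section Dominated.
Context d (T : measurableType d) (R : realType).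
Variable mu : {finite_measure set T -> \bar R}.

(** Uniform over all measures below [mu]: [mu] itself is small where g is
    close to 0, and elsewhere Markov's inequality applies. *)
Lemma small_integral_small_measure (g : T -> R) D e :
  measurable_fun setT g -> measurable D -> (forall x, D x -> 0 < g x) ->
  0 < e ->
  exists2 dl, 0 < dl & forall nu : {measure set T -> \bar R},
    (forall B, measurable B -> (nu B <= mu B)%E) ->
    (\int[nu]_(x in D) (g x)%:E <= dl%:E)%E -> (nu D <= e%:E)%E.
Proof.
move=> mg mD g0 e0; pose U n := D `&` [set x | g x < n.+1%:R^-1].
have mlt c : measurable [set x | g x < c] by exact: measurable_lt_set.
have mU n : measurable (U n) by exact: measurableI.
have UE : \bigcap_n U n = set0.
  apply/seteqP; split => // x Ux.
  have [Dx _] := Ux 0%N I.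
  have := g0 _ Dx; move=> /ltr_add_invr[n]; rewrite add0r => hn.
  by have [_ /=] := Ux n I; rewrite ltNge ltW.
have cvgU : mu \o U @ \oo --> mu (\bigcap_n U n).
  apply: nonincreasing_cvg_mu => // [||n m nm].
  - by rewrite ltey_eq fin_num_measure.
  - by rewrite UE.
  - apply/subsetPset; apply: setIS => x /= /lt_le_trans; apply.
    by rewrite lef_pV2 ?posrE// ler_nat.
have [n Un] : exists n, (mu (U n) <= (e / 2)%:E)%E.
  apply: contrapT => /forallNP Une.
  have : ((e / 2)%:E <= mu (\bigcap_n U n))%E.
    apply: (cvge_to_ge cvgU); apply: nearW => n.
    by have /negP := Une n; rewrite -ltNge => /ltW.
  by rewrite UE measure0 lee_fin leNgt divr_gt0.
have n0 : (0 : R) < n.+1%:R^-1 by rewrite invr_gt0.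
exists (n.+1%:R^-1 * (e / 2)); first by rewrite mulr_gt0// divr_gt0.
move=> nu numu Dint.
pose V := D `\` U n.
have mV : measurable V by exact: measurableD.
have VD : V `<=` D by exact: subDsetl.
have mgD : measurable_fun D (EFin \o g).
  by apply/measurable_EFinP; exact: measurable_funTS.
have nuV : (nu V <= (e / 2)%:E)%E.
  rewrite -(lee_pmul2l (_ : n.+1%:R^-1%:E \is a fin_num)) ?lte_fin//.
  rewrite -EFinM; apply: le_trans Dint.
  rewrite -integral_cst//.
  apply: le_trans (ge0_subset_integral nu mV mD mgD _ VD).
    apply: ge0_le_integral => //.
    - by move=> x _; rewrite lee_fin ltW.
    - exact: measurable_funS mD VD mgD.
    - move=> x [Dx Ux]; rewrite lee_fin leNgt; apply/negP => gx.
      by apply: Ux.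
  by move=> x /g0 gx; rewrite lee_fin ltW.
have -> : D = U n `|` V by rewrite /V setDUK//; exact: subIsetl.
apply: le_trans (measureU2 _ _ _) _ => //.
rewrite [e in leRHS]splitr EFinD; apply: leeD => //.
by apply: le_trans Un; exact: numu.
Qed.

End Dominated.

Section Splittings.
Context d (T : measurableType d) (R : realType).
Variables (mu : {finite_measure set T -> \bar R}) (N : nat).

Definition splitting (nu : 'I_N -> {measure set T -> \bar R}) : Prop :=
  forall B, measurable B -> (\sum_(i < N) nu i B)%E = mu B.

Variable nu : 'I_N -> {measure set T -> \bar R}.
Hypothesis numu : splitting nu.

Lemma splitting_le i B : measurable B -> (nu i B <= mu B)%E.
Proof.
move=> mB; rewrite -numu// (bigD1 i)//= leeDl//.
by apply: sume_ge0 => j _.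
Qed.

Lemma splitting_lty i B : measurable B -> (nu i B < +oo)%E.
Proof.
move=> mB; apply: le_lt_trans (splitting_le i mB) _.
by rewrite ltey_eq fin_num_measure.
Qed.

Lemma splitting_integral (f : T -> R) D :
  measurable D -> measurable_fun setT f -> (forall x, 0 <= f x) ->
  (\int[mu]_(x in D) (f x)%:E = \sum_(i < N) \int[nu i]_(x in D) (f x)%:E)%E.
Proof.
move=> mD mf f0.
(* [msum] adds up sequences of measures: pad [nu] with zero measures *)
pose nu' k : {measure set T -> \bar R} := oapp nu mzero (insub k).
have nu'E (i : 'I_N) : nu' i = nu i by rewrite /nu' valK.
rewrite (eq_measure_integral (msum nu' N)) => [|A mA _]; last first.
  by rewrite /= /msum -numu//; apply: eq_bigr => i _; rewrite nu'E.
rewrite ge0_integral_measure_sum//.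
- by apply: eq_bigr => i _; rewrite nu'E.
- by move=> x _; rewrite lee_fin.
- by apply/measurable_EFinP; exact: measurable_funTS.
Qed.

End Splittings.

Section Restrictions.
Context d (T : measurableType d) (R : realType).
Variables (mu : {measure set T -> \bar R}) (N : nat).
Variables (A : 'I_N -> set T).
Hypothesis mA : forall i, measurable (A i).

Lemma measure_null_overlap B : measurable B -> (mu B < +oo)%E ->
  (forall i j, i != j -> mu (A i `&` A j) = 0%E) ->
  \bigcup_i A i = setT ->
  (\sum_(i < N) mu (B `&` A i))%E = mu B.
Proof.
move=> mB Boo A0 AT.
have mU (r : seq 'I_N) : measurable (\big[setU/set0]_(i <- r) A i).
  by apply: bigsetU_measurable => i _.
suff H (r : seq 'I_N) : uniq r ->
    (\sum_(i <- r) mu (B `&` A i))%E = mu (B `&` \big[setU/set0]_(i <- r) A i).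
  rewrite H ?index_enum_uniq// -bigcup_seq.
  rewrite (_ : \bigcup_(i in _) A i = setT) ?setIT// -AT.
  by apply: eq_bigcupl; split => i //= _; exact: mem_index_enum.
elim: r => [|i r IH]; first by rewrite !big_nil setI0 measure0.
move=> /= /andP[ir ur]; rewrite !big_cons IH// setIUr.
have mI j : measurable (B `&` A j) by exact: measurableI.
have mIU : measurable (B `&` \big[setU/set0]_(i <- r) A i).
  exact: measurableI.
rewrite measureUfinl//; last first.
  by apply: le_lt_trans Boo; apply: le_measure; rewrite ?inE.
rewrite [X in (_ - X)%E](_ : _ = 0%E) ?sube0//.
apply/eqP; rewrite eq_le measure_ge0 andbT.
have sub : B `&` A i `&` (B `&` \big[setU/set0]_(i <- r) A i) `<=`
    \big[setU/set0]_(j <- r) (A i `&` A j).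
  move=> x [[_ ix]] [_]; rewrite -!bigcup_seq => -[j /= jr jx].
  by exists j.
have mAA j : measurable (A i `&` A j) by exact: measurableI.
apply: le_trans (le_measure mu _ _ sub) _; rewrite ?inE.
- by apply: measurableI.
- by apply: bigsetU_measurable => j _.
apply: le_trans (_ : (\sum_(j <- r) mu (A i `&` A j) <= _)%E).
  elim: r {IH ir ur sub mIU} => [|j r IH]; first by rewrite !big_nil measure0.
  rewrite !big_cons; apply: le_trans (measureU2 _ _ _) _ => //.
    by apply: bigsetU_measurable => k _.
  exact: leeD2l.
rewrite big_seq big1// => j jr; apply: A0; apply: contraNneq ir => ->//.
Qed.

Definition restrictions i : {measure set T -> \bar R} := mrestr mu (mA i).

Lemma integral_restrictions i (f : T -> R) : measurable_fun setT f ->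
  (forall x, 0 <= f x) ->
  (\int[restrictions i]_x (f x)%:E = \int[mu]_(x in A i) (f x)%:E)%E.
Proof.
move=> mf f0; rewrite -(setvU (A i)) ge0_integral_setU//=.
- rewrite [X in (X + _)%E](_ : _ = 0%E) ?add0e.
    apply: eq_measure_integral => B mB BA.
    by rewrite /= /mrestr setIidl.
  rewrite -(integral_measure_zero (~` A i) (fun x => (f x)%:E)).
  apply: eq_measure_integral => B mB BA.
  rewrite /= /mrestr (_ : _ `&` _ = set0) ?measure0//.
  by apply/seteqP; split => // x [/BA].
- exact: measurableC.
- by apply/measurable_EFinP; exact: measurable_funTS.
- by move=> x _; rewrite lee_fin.
- by apply/disj_setPS => x [].
Qed.

End Restrictions.

(** * Cells of a supporting vector *)

Section Cells.
Context d (T : measurableType d) (R : realType).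
Variables (N : nat) (psi : 'I_N -> T -> R) (K : R).
Hypothesis mpsi : forall i, measurable_fun setT (psi i).
Hypothesis psi0 : forall i x, 0 <= psi i x.
Hypothesis psiK : forall i x, psi i x <= K.
Hypothesis K0 : 0 <= K.

Variable l : 'rV[R]_N.

Definition weighted i x : R := l ord0 i * psi i x.

Lemma measurable_weighted i : measurable_fun setT (weighted i).
Proof. by apply: measurable_funM => //; exact: measurable_cst. Qed.

(** Taking the first maximizing index makes the cells disjoint, so that they
    form a strong partition even when ties are not null. *)
Definition cell i : set T :=
  [set x | (forall j, weighted j x <= weighted i x) /\
           (forall j : 'I_N, (j < i)%N -> weighted j x < weighted i x)].

Lemma measurable_cell i : measurable (cell i).
Proof.
have mw := measurable_weighted.
rewrite (_ : cell i =
    \bigcap_(j in [set: 'I_N]) [set x | weighted j x <= weighted i x] `&`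
    \bigcap_(j in [set j : 'I_N | (j < i)%N])
      [set x | weighted j x < weighted i x]).
  apply: measurableI; apply: fin_bigcap_measurable => // j _.
    exact: measurable_le_set.
  exact: measurable_lt_set.
apply/seteqP; split => [x [h1 h2]|x [h1 h2]]; split=> j //.
- by move=> _; exact: h1.
- exact: h2.
- exact: (h1 j).
- exact: (h2 j).
Qed.

Lemma cell_cover (i0 : 'I_N) x : exists i, cell i x.
Proof.
have [i1 _ h1] : exists2 i1, true & forall j, weighted j x <= weighted i1 x.
  have [i1 _ h1] := @arg_maxP _ _ _ i0 xpredT (weighted^~ x) isT.
  by exists i1 => // j; exact: h1.
have [i /eqP wi hi] :=
  @arg_minnP _ i1 (fun i => weighted i x == weighted i1 x) val (eqxx _).
exists i; split=> [j|j ji]; first by rewrite wi; exact: h1.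
rewrite wi lt_neqAle h1 andbT; apply/negP => /hi /=.
by rewrite leqNgt ji.
Qed.

Lemma cell_disjoint i j x : cell i x -> cell j x -> i = j.
Proof.
move=> [i1 i2] [j1 j2]; apply/val_inj/eqP; rewrite eqn_leq.
apply/andP; split; rewrite leqNgt; apply/negP.
  by move=> /i2; rewrite ltNge j1.
by move=> /j2; rewrite ltNge i1.
Qed.

Lemma cell_trivIset D : trivIset D cell.
Proof. by move=> i j _ _ [x [ix jx]]; exact: cell_disjoint ix jx. Qed.

Lemma bigcup_cell (i0 : 'I_N) : \big[setU/set0]_(i < N) cell i = setT.
Proof.
apply/seteqP; split => // x _; have [i ix] := cell_cover i0 x.
by rewrite -bigcup_seq; exists i => //=; exact: mem_index_enum.
Qed.

Variable mu : {finite_measure set T -> \bar R}.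

Definition optimum : 'rV[R]_N := \row_i \int[mu]_(x in cell i) psi i x.

Definition moment (nu : 'I_N -> {measure set T -> \bar R}) : 'rV[R]_N :=
  \row_i \int[nu i]_x psi i x.

Section OneSplitting.
Variable nu : 'I_N -> {measure set T -> \bar R}.
Hypothesis numu : splitting mu nu.

Lemma integrable_psi (nu' : {measure set T -> \bar R}) k D :
  measurable D -> (nu' D < +oo)%E -> nu'.-integrable D (EFin \o psi k).
Proof.
move=> mD nuD; apply: measurable_bounded_integrable => //.
  exact: measurable_funTS.
exists K; split; first exact: num_real.
move=> M KM x _ /=; rewrite ger0_norm//.
exact: le_trans (psiK k x) (ltW KM).
Qed.

Lemma Rintegral_psi_ge0 (nu' : {measure set T -> \bar R}) k D :
  0 <= \int[nu']_(x in D) psi k x.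
Proof. by apply: Rintegral_ge0. Qed.

Lemma Rintegral_psi_le (nu' : {measure set T -> \bar R}) k D :
  measurable D -> (nu' D < +oo)%E ->
  \int[nu']_(x in D) psi k x <= K * fine (nu' D).
Proof.
move=> mD nuD; rewrite -Rintegral_cst//; apply: le_Rintegral => //.
  exact: integrable_psi.
apply: measurable_bounded_integrable => //.
by exists `|K|; split; [exact: num_real|move=> M KM x _ /=; exact: ltW].
Qed.

Lemma momentE j : moment nu ord0 j = \sum_i \int[nu j]_(x in cell i) psi j x.
Proof.
rewrite mxE.
have EF i : (\int[nu j]_(x in cell i) (psi j x)%:E)%E =
    (\int[nu j]_(x in cell i) psi j x)%R%:E.
  rewrite fineK//; apply: integrable_fin_num; first exact: measurable_cell.
  by apply: integrable_psi; [exact: measurable_cell|];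
    apply: (splitting_lty numu); exact: measurable_cell.
rewrite {1}/Rintegral -(bigcup_cell j) ge0_integral_bigsetU//.
- by under eq_bigr do rewrite EF; rewrite sumEFin.
- exact: measurable_cell.
- exact: index_enum_uniq.
- exact: cell_trivIset.
- by apply/measurable_EFinP; exact: measurable_funTS.
- by move=> x _; rewrite lee_fin.
Qed.

Lemma optimumE i : optimum ord0 i = \sum_j \int[nu j]_(x in cell i) psi i x.
Proof.
rewrite mxE {1}/Rintegral.
rewrite (splitting_integral numu (measurable_cell i) (mpsi i) (psi0 i)).
rewrite [X in fine X](_ : _ = (\sum_j \int[nu j]_(x in cell i) psi i x)%R%:E)//.
rewrite -sumEFin; apply: eq_bigr => j _.
rewrite fineK//; apply: integrable_fin_num; first exact: measurable_cell.
by apply: integrable_psi; [exact: measurable_cell|];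
  apply: (splitting_lty numu); exact: measurable_cell.
Qed.

Lemma integrable_gain i j :
  (nu j).-integrable (cell i) (EFin \o (fun x => weighted i x - weighted j x)).
Proof.
have mc := measurable_cell i.
have nc := splitting_lty numu j mc.
have ip k := integrableZl mc (l ord0 k) (integrable_psi k mc nc).
exact: eq_integrable (integrableB mc (ip i) (ip j)).
Qed.

Lemma gainE i j :
  \int[nu j]_(x in cell i) (weighted i x - weighted j x) =
  l ord0 i * \int[nu j]_(x in cell i) psi i x -
  l ord0 j * \int[nu j]_(x in cell i) psi j x.
Proof.
have mc := measurable_cell i.
have nc := splitting_lty numu j mc.
have ip k := integrable_psi k mc nc.
rewrite RintegralB//; first by rewrite !RintegralZl.
all: exact: eq_integrable (integrableZl mc _ (ip _)).
Qed.

Lemma gain_ge0 i j :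
  0 <= \int[nu j]_(x in cell i) (weighted i x - weighted j x).
Proof. by apply: Rintegral_ge0 => x [+ _]; rewrite subr_ge0; exact. Qed.

(** Both moment vectors are sums over the pairs (i, j) of integrals over the i-th
    cell against nu_j. *)
Lemma deficitE : dot l optimum - dot l (moment nu) =
  \sum_i \sum_j \int[nu j]_(x in cell i) (weighted i x - weighted j x).
Proof.
under [RHS]eq_bigr do under eq_bigr do rewrite gainE.
under [RHS]eq_bigr do rewrite sumrB.
rewrite sumrB; congr (_ - _).
  by apply: eq_bigr => i _; rewrite optimumE mulr_sumr.
rewrite exchange_big; apply: eq_bigr => j _.
by rewrite momentE mulr_sumr.
Qed.

Lemma gain_le_deficit i j :
  \int[nu j]_(x in cell i) (weighted i x - weighted j x) <=
  dot l optimum - dot l (moment nu).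
Proof.
rewrite deficitE (bigD1 i)//= (bigD1 j)//= -addrA lerDl addr_ge0//.
  by apply: sumr_ge0 => k _; exact: gain_ge0.
by apply: sumr_ge0 => k _; apply: sumr_ge0 => k' _; exact: gain_ge0.
Qed.

Lemma Rintegral_cell_small e i j k : (nu j (cell i) <= e%:E)%E ->
  \int[nu j]_(x in cell i) psi k x <= K * e.
Proof.
move=> small; have mc := measurable_cell i; have nc := splitting_lty numu j mc.
apply: le_trans (Rintegral_psi_le k mc nc) _.
by rewrite ler_wpM2l// -lee_fin fineK// ge0_fin_numE.
Qed.

Lemma moment_small e j :
  (forall i, (nu j (cell i) <= e%:E)%E) -> moment nu ord0 j <= N%:R * (K * e).
Proof.
move=> small; rewrite momentE -[N in leRHS]card_ord mulr_natl -sumr_const.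
by apply: ler_sum => i _; exact: Rintegral_cell_small.
Qed.

(** The diagonal terms of [momentE] and [optimumE] agree; the off-diagonal ones
    are integrals against nu_j over cells of small nu_j-mass. *)
Lemma moment_close e : 0 <= e ->
  (forall i j, i != j -> (nu j (cell i) <= e%:E)%E) ->
  forall j, `|moment nu ord0 j - optimum ord0 j| <= N%:R * (K * e).
Proof.
move=> e0 small j.
have offdiag (F : 'I_N -> R) : (forall i, i != j -> 0 <= F i <= K * e) ->
    0 <= \sum_(i | i != j) F i <= N%:R * (K * e).
  move=> FK; apply/andP; split; first by apply: sumr_ge0 => i /FK/andP[].
  rewrite -[N in leRHS]card_ord mulr_natl -sumr_const.
  rewrite [leRHS](bigID (predC1 j))/=.
  rewrite -[leLHS]addr0 lerD//; first by apply: ler_sum => i /FK/andP[].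
  by apply: sumr_ge0 => i _; exact: mulr_ge0.
rewrite momentE optimumE (bigD1 j)//= [X in _ - X](bigD1 j)//=.
rewrite opprD addrACA subrr add0r.
have /andP[a0 aK] : 0 <= \sum_(i | i != j) \int[nu j]_(x in cell i) psi j x
    <= N%:R * (K * e).
  apply: offdiag => i ij; rewrite Rintegral_psi_ge0 /=.
  by apply: Rintegral_cell_small; exact: small.
have /andP[b0 bK] : 0 <= \sum_(i | i != j) \int[nu i]_(x in cell j) psi j x
    <= N%:R * (K * e).
  apply: offdiag => i ij; rewrite Rintegral_psi_ge0 /=.
  by apply: Rintegral_cell_small; apply: small; rewrite eq_sym.
rewrite ler_norml; lra.
Qed.

End OneSplitting.

(** The j-th measure of a nearly optimal splitting hardly charges the i-th cell:
    moving its mass there from j to i would gain l_i psi_i - l_j psi_j, which is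
    positive on the cell off the null set of ties. *)
Lemma leak i j e :
  mu (cell i `&` [set x | weighted i x = weighted j x]) = 0%E ->
  0 < e -> exists2 dl, 0 < dl & forall nu : 'I_N -> {measure set T -> \bar R},
    splitting mu nu ->
    dot l optimum - dot l (moment nu) <= dl -> (nu j (cell i) <= e%:E)%E.
Proof.
move=> tie e0.
have mw := measurable_weighted.
pose D := cell i `&` [set x | weighted j x < weighted i x].
have mc := measurable_cell i.
have mD : measurable D by apply: measurableI => //; exact: measurable_lt_set.
have [||dl dl0 H] := @small_integral_small_measure _ _ _ mu
  (fun x => weighted i x - weighted j x) D e _ mD _ e0.
- exact: measurable_funB.
- by move=> x [_ /=]; rewrite subr_gt0.
exists dl => // nu numu def.
have nuj := splitting_le numu j.
have mtie : measurable (cell i `&` [set x | weighted i x = weighted j x]).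
  by apply: measurableI => //; exact: measurable_eq_set.
have -> : cell i = D `|` (cell i `&` [set x | weighted i x = weighted j x]).
  apply/seteqP; split => [x ix|x [[]|[]]//].
  have := ix.1 j; rewrite le_eqVlt => /predU1P[eq|lt]; [right|left] => //.
apply: le_trans (measureU2 _ mD mtie) _.
rewrite -[leRHS]adde0; apply: leeD; last by rewrite -tie; exact: nuj.
apply: H => //.
have mg : measurable_fun (cell i)
    (EFin \o (fun x => weighted i x - weighted j x)).
  by apply/measurable_EFinP; apply: measurable_funTS; exact: measurable_funB.
apply: le_trans (ge0_subset_integral (nu j) mD mc mg _ _) _.
- by move=> x [+ _]; rewrite lee_fin subr_ge0; exact.
- exact: subIsetl.
rewrite -[leLHS]fineK ?lee_fin; last first.
  exact: (integrable_fin_num mc (integrable_gain numu i j)).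
exact: le_trans (gain_le_deficit numu i j) def.
Qed.

End Cells.

Section Rigidity.
Context d (T : measurableType d) (R : realType).
Variables (N : nat) (psi : 'I_N -> T -> R) (K : R).
Hypothesis mpsi : forall i, measurable_fun setT (psi i).
Hypothesis psi0 : forall i x, 0 <= psi i x.
Hypothesis psiK : forall i x, psi i x <= K.
Hypothesis K0 : 0 <= K.
Variables (l : 'rV[R]_N) (mu : {finite_measure set T -> \bar R}).

Definition null_tie i j : Prop :=
  mu (cell psi l i `&` [set x | weighted psi l i x = weighted psi l j x]) = 0%E.

Lemma leak_uniform (P : 'I_N -> 'I_N -> Prop) e :
  (forall i j, P i j -> null_tie i j) -> 0 < e ->
  exists2 dl, 0 < dl & forall nu, splitting mu nu ->
    dot l (optimum psi l mu) - dot l (moment psi nu) <= dl ->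
    forall i j, P i j -> (nu j (cell psi l i) <= e%:E)%E.
Proof.
move=> tie e0.
have /choice[D HD] (ij : 'I_N * 'I_N) : exists dl, 0 < dl /\
    (P ij.1 ij.2 -> forall nu, splitting mu nu ->
      dot l (optimum psi l mu) - dot l (moment psi nu) <= dl ->
      (nu ij.2 (cell psi l ij.1) <= e%:E)%E).
  have [Pij|nP] := pselect (P ij.1 ij.2); last by exists 1; split.
  by have [dl dl0 H] := leak mpsi psi0 psiK (tie _ _ Pij) e0; exists dl.
exists (\big[Num.min/1]_ij D ij).
  by elim/big_ind: _ => // [a b a0 b0|ij _]; [rewrite lt_min a0|case: (HD ij)].
move=> nu nus def i j Pij; have [_] := HD (i, j); apply => //.
by apply: le_trans def _; exact: bigmin_le_cond.
Qed.

(** Without deficit nothing leaks: each nu_j lives on the j-th cell, where it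
    must be all of mu. *)
Lemma rigidity nu : (forall i j, i != j -> null_tie i j) -> splitting mu nu ->
  dot l (optimum psi l mu) <= dot l (moment psi nu) ->
  moment psi nu = optimum psi l mu /\
  forall j B, measurable B -> nu j B = mu (B `&` cell psi l j).
Proof.
move=> tie nus def.
have mc i : measurable (cell psi l i) by exact: measurable_cell.
have off i j : i != j -> nu j (cell psi l i) = 0%E.
  move=> ij; apply/eqP; rewrite eq_le measure_ge0 andbT.
  apply/lee_addgt0Pr => e e0; rewrite add0e.
  have [dl dl0 H] := @leak_uniform (fun i j => i != j) e tie e0.
  by apply: (H nu nus) => //; rewrite (le_trans _ (ltW dl0))// subr_le0.
split.
  apply/rowP => j; apply/eqP; rewrite -subr_eq0 -normr_le0.
  have := @moment_close _ _ _ _ _ _ mpsi psi0 psiK K0 l mu nu nus 0 (lexx _).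
  by rewrite !mulr0; apply => i k ik; rewrite off.
have offB i j B : measurable B -> i != j -> nu j (B `&` cell psi l i) = 0%E.
  move=> mB ij; apply/eqP; rewrite eq_le measure_ge0 andbT -(off _ _ ij).
  by apply: le_measure; rewrite ?inE//; exact: measurableI.
move=> j B mB; rewrite -nus; last exact: measurableI.
rewrite (bigD1 j)//= big1 ?adde0; last by move=> i ij; rewrite offB// eq_sym.
have cT : \bigcup_i cell psi l i = setT.
  apply/seteqP; split => // x _.
  by have [i ix] := cell_cover psi l j x; exists i.
rewrite -(measure_null_overlap mc mB (splitting_lty nus j mB) _ cT).
  by rewrite (bigD1 j)//= big1 ?adde0// => i ij; rewrite offB.
move=> i k ik; rewrite (_ : _ `&` _ = set0) ?measure0//.
apply/seteqP; split => // x [ix kx].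
by move/eqP: ik; apply; exact: cell_disjoint ix kx.
Qed.

End Rigidity.

(** * Convexity of the attainable set *)

Lemma continuous_borel_measurable (R : realType) (X : ptopologicalType)
    (f : X -> R) :
  continuous f -> measurable_fun [set: borel X] f.
Proof.
move=> /continuousP cf.
apply: (measurability _ (RGenOInfty.measurableE R)) => _ [_ [x ->] <-].
by rewrite setTI; apply: sub_sigma_algebra; apply: cf; exact: interval_open.
Qed.

Section Attainable.
Variables (R : realType) (X : ptopologicalType) (N : nat).
Variables (mu : probability (borel X) R) (psi : 'I_N -> X -> R) (K : R).
Hypothesis mpsi : forall i, measurable_fun [set: borel X] (psi i).
Hypothesis psi0 : forall i x, 0 <= psi i x.
Hypothesis psiK : forall i x, psi i x <= K.
Hypothesis K0 : 0 <= K.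

Let mu_lty (A : set (borel X)) : measurable A -> (mu A < +oo)%E.
Proof. by move=> mA; rewrite ltey_eq fin_num_measure. Qed.

Lemma integral_psiE i (A : set (borel X)) : measurable A ->
  (\int[mu]_(x in A) (psi i x)%:E)%E = (\int[mu]_(x in A) psi i x)%:E.
Proof.
move=> mA; rewrite fineK//; apply: integrable_fin_num => //.
exact: (integrable_psi mpsi psi0 psiK i mA (mu_lty mA)).
Qed.

Lemma finitely_additive_psi i (A : set (borel X)) : measurable A ->
  finitely_additive (fun B : set (borel X) => \int[mu]_(x in B `&` A) psi i x).
Proof.
move=> mA; split=> [B mB|B C mB mC BC]; first exact: Rintegral_psi_ge0.
have mBA : measurable (B `&` A) by exact: measurableI.
have mCA : measurable (C `&` A) by exact: measurableI.
rewrite setIUl Rintegral_setU//.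
  apply: (integrable_psi mpsi psi0 psiK) => //; first exact: measurableU.
  exact: mu_lty (measurableU _ _ mBA mCA).
by apply/disj_setPS => x [[Bx _] [Cx _]]; rewrite -BC.
Qed.

Lemma finitely_additive_fine :
  finitely_additive (fun B : set (borel X) => fine (mu B)).
Proof.
split=> [B mB|B C mB mC BC]; first exact: fine_ge0.
by rewrite measureU// fineD ?fin_num_measure//.
Qed.

(** Let S be a set that contains the fraction t of [A i] and of [B i], as
    measured by psi_i, for every i.  Following the partition B inside S and the
    partition A outside it attains the convex combination of the two moment
    vectors. *)
Lemma strong_attainable_convex :
  (forall A : set (borel X), measurable A -> exists B : set (borel X),
    [/\ measurable B, B `<=` A & fine (mu B) = fine (mu A) / 2]) ->
  convex_subset (strong_attainable mu psi).
Proof.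
move=> half a b [A [mA AT A0 Aa]] [B [mB BT B0 Bb]] _ [t t01 <-].
pose E (bk : bool * 'I_N) := if bk.1 then A bk.2 else B bk.2.
have mE bk : measurable (E bk) by case: bk => -[] k; [exact: mA|exact: mB].
(* v 0 is mu; the other indices code the pairs of a partition and a piece *)
pose v n : set (borel X) -> R := if n is n'.+1 then
    (if unpickle n' is Some bk then
       fun C => \int[mu]_(x in C `&` E bk) psi bk.2 x else cst 0)
  else fun C => fine (mu C).
have vf n : finitely_additive (v n).
  case: n => [|n] /=; first exact: finitely_additive_fine.
  case: unpickle => [bk|]; first exact: finitely_additive_psi.
  by split=> // *; rewrite addr0.
have vM n C : measurable C -> v n C <= (K + 1) * v 0%N C.
  move=> mC; have C0 : 0 <= fine (mu C) by exact: fine_ge0.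
  case: n => [|n] /=; first by rewrite ler_peMl// lerDr.
  case: unpickle => [bk|]; last by rewrite mulr_ge0// addr_ge0.
  have mCE : measurable (C `&` E bk) by exact: measurableI.
  apply: le_trans (Rintegral_psi_le mpsi psi0 psiK _ mCE (mu_lty mCE)) _.
  rewrite ler_pM// ?fine_ge0// ?lerDl// fine_le ?fin_num_measure//.
  by apply: le_measure; rewrite ?inE//; exact: subIsetl.
have h1 : halvable v 1.
  move=> C mC; have [D [mD DC Dhalf]] := half C mC.
  by exists D; split => // -[].
pose n := (\max_(bk : bool * 'I_N) pickle bk).+1.
have cn : chainable v n.+1 by exact: lyapunov vM h1.
have [S [mS _ _ Sv]] := cn setT measurableT.
have Svt bk : \int[mu]_(x in S t `&` E bk) psi bk.2 x =
    t * \int[mu]_(x in E bk) psi bk.2 x.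
  have := Sv t (pickle bk).+1 t01; rewrite /v pickleK setTI; apply.
  by rewrite !ltnS; exact: (leq_bigmax bk).
pose C i := (S t `&` B i) `|` (A i `\` S t).
have mSB i : measurable (S t `&` B i) by exact: measurableI.
have mAS i : measurable (A i `\` S t) by exact: measurableD.
have mSA i : measurable (S t `&` A i) by exact: measurableI.
exists C; split.
- by move=> i; exact: measurableU.
- apply/seteqP; split => // x _; have [Sx|nSx] := pselect (S t x).
    by have [i _ ix] : (\bigcup_i B i) x by [rewrite BT]; exists i => //; left.
  by have [i _ ix] : (\bigcup_i A i) x by [rewrite AT]; exists i => //; right.
- move=> i j ij; apply/eqP; rewrite eq_le measure_ge0 andbT.
  rewrite -[leRHS]adde0 -[X in (_ <= X + _)%E](A0 i j ij) -(B0 i j ij).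
  have mAA := measurableI _ _ (mA i) (mA j).
  have mBB := measurableI _ _ (mB i) (mB j).
  apply: le_trans (_ : (mu ((A i `&` A j) `|` (B i `&` B j)) <= _)%E);
    last exact: measureU2.
  apply: le_measure; rewrite ?inE.
  + by apply: measurableI; exact: measurableU.
  + exact: measurableU.
  + by move=> x [[[Sx Bi]|[Ai nS]] [[? ?]|[? ?]]] //; [right|left].
- move=> i; rewrite integral_psiE; last exact: measurableU.
  have ASE : A i = (S t `&` A i) `|` (A i `\` S t).
    by rewrite setIC -{1}(setUIDK (A i) (S t)).
  have ip (D : set (borel X)) :
      measurable D -> mu.-integrable D (EFin \o psi i).
    by move=> mD; exact: (integrable_psi mpsi psi0 psiK i mD (mu_lty mD)).
  have Ai : \int[mu]_(x in A i) psi i x = a ord0 i by rewrite /Rintegral Aa.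
  have Bi : \int[mu]_(x in B i) psi i x = b ord0 i by rewrite /Rintegral Bb.
  have SA := Svt (true, i); have SB := Svt (false, i).
  rewrite /E /= Ai in SA; rewrite /E /= Bi in SB.
  have : \int[mu]_(x in A i) psi i x =
      \int[mu]_(x in S t `&` A i) psi i x + \int[mu]_(x in A i `\` S t) psi i x.
    rewrite {1}ASE Rintegral_setU//; first by apply: ip; exact: measurableU.
    by apply/disj_setPS => x [[? _] []].
  rewrite Ai SA => AE.
  rewrite /C Rintegral_setU//; last 2 first.
  + by apply: ip; exact: measurableU.
  + by apply/disj_setPS => x [[? _] []].
  by congr EFin; rewrite SB !mxE; lra.
Qed.

End Attainable.

(** * Boundary points *)

Lemma mean_upper_bounds (R : realFieldType) (t x y z : R) : 0 < t -> t < 1 ->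
  z = (1 - t) * x + t * y -> x <= z -> y <= z -> z <= x /\ z <= y.
Proof.
move=> t0 t1 zE xz yz.
have hx : (1 - t) * x <= (1 - t) * z by rewrite ler_pM2l// subr_gt0.
have hy : t * y <= t * z by rewrite ler_pM2l.
split; last by rewrite -(ler_pM2l t0); lra.
by rewrite -(ler_pM2l (_ : 0 < 1 - t)) ?subr_gt0//; lra.
Qed.

Section Assembly.
Variables (R : realType) (X : ptopologicalType) (N : nat).
Variables (mu : probability (borel X) R) (psi : 'I_N -> X -> R).

Lemma weak_partition_moment m nu :
  weak_partitions mu psi m nu -> moment (T := borel X) psi nu = m.
Proof. by move=> [_ nuE]; apply/rowP => i; rewrite mxE /Rintegral nuE. Qed.

Lemma strong_partition_weak m A :
  (forall i, measurable_fun [set: borel X] (psi i)) ->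
  (forall i x, 0 <= psi i x) ->
  strong_partitions mu psi m A ->
  exists nu : 'I_N -> {measure set (borel X) -> \bar R},
    weak_partitions mu psi m nu /\
    forall i B, measurable B -> nu i B = mu (B `&` A i).
Proof.
move=> mpsi psi0 [mA AT A0 AE]; exists (restrictions mu mA); split => //.
split=> [B mB|i]; last first.
  by rewrite (integral_restrictions mu mA i (mpsi i) (psi0 i)) AE.
by apply: measure_null_overlap => //; rewrite ltey_eq fin_num_measure.
Qed.

Lemma bounded_family : compact [set: X] -> (forall i, continuous (psi i)) ->
  exists2 K, 0 <= K & forall i x, psi i x <= K.
Proof.
move=> hX hc.
have /choice[K HK] i : exists K, forall x, psi i x <= K.
  have : compact [set psi i x | x in [set: X]].
    by apply: continuous_compact => //; apply: continuous_subspaceT; exact: hc.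
  move=> /compact_bounded[M [_ MP]]; exists (M + 1) => x.
  apply: le_trans (ler_norm _) _.
  by apply: (MP (M + 1)); [rewrite ltrDl|exists x].
exists (\big[Num.max/0]_i K i); first by apply/bigmax_geP; left.
by move=> i x; apply: le_trans (HK i x) _; by apply/bigmax_geP; right; exists i.
Qed.

(** The ratio psi_i / (psi_i + psi_j) is bounded, and each of its level sets is
    the zero set of a nontrivial combination of psi_i and psi_j, hence null. *)
Lemma ratio_halving i j : continuous (psi i) -> continuous (psi j) ->
  (forall x, 0 < psi i x) -> (forall x, 0 < psi j x) ->
  (forall alpha beta : R, 0 < alpha ^+ 2 + beta ^+ 2 ->
     mu [set x : X | alpha * psi i x + beta * psi j x = 0] = 0%E) ->
  forall A : set (borel X), measurable A -> exists B : set (borel X),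
    [/\ measurable B, B `<=` A & fine (mu B) = fine (mu A) / 2].
Proof.
move=> ci cj pi0 pj0 hpsi A mA.
have s0 x : 0 < psi i x + psi j x by rewrite addr_gt0.
pose g x := psi i x / (psi i x + psi j x).
apply: (@halve_level_sets _ _ _ mu g 1) => //.
- apply: continuous_borel_measurable => x; apply: cvgM; first exact: ci.
  by apply: cvgV; [rewrite gt_eqF|apply: cvgD; [exact: ci|exact: cj]].
- move=> x; rewrite /g ger0_norm ?divr_ge0 ?(ltW (s0 x)) ?(ltW (pi0 x))//.
  by rewrite ler_pdivrMr// mul1r lerDl ltW.
- move=> c; rewrite -(hpsi (1 - c) (- c)); last by nra.
  congr (mu _); apply/seteqP; split => x /=.
    move=> /(congr1 ( *%R^~ (psi i x + psi j x))).
    by rewrite divfK ?gt_eqF//; lra.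
  by move=> h; apply: (mulIf (lt0r_neq0 (s0 x))); rewrite divfK ?gt_eqF//; lra.
Qed.

End Assembly.

Theorem proposition4p1 (R : realType) (X : ptopologicalType)
    (hcompact : compact [set: X]) (hpolish : polish_space R X)
    (mu : probability (borel X) R) (hmu : nonatomic mu)
    (N : nat) (psi : 'I_N -> X -> R)
    (hcont : forall i, continuous (psi i))
    (hpos : forall i x, 0 < psi i x)
    (hpsi : forall i j, i != j -> forall alpha beta : R,
       0 < alpha ^+ 2 + beta ^+ 2 ->
       mu [set x : X | alpha * psi i x + beta * psi j x = 0] = 0%E)
    (m : 'rV[R]_N)
    (hm : boundary (strong_attainable mu psi) m)
    (hmpos : forall i, 0 < m ord0 i) :
  exposed_point (strong_attainable mu psi) m /\
  exists nu : 'I_N -> {measure set (borel X) -> \bar R},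
    [/\ weak_partitions mu psi m nu,
        forall nu', weak_partitions mu psi m nu' -> same_measures nu' nu &
        weak_is_strong mu psi m nu].
Proof.
have mpsi i : measurable_fun [set: borel X] (psi i).
  exact: continuous_borel_measurable.
have psi0 i x : 0 <= psi i x by exact: ltW.
have [K K0 psiK] := bounded_family hcompact hcont.
case: hm => clm nintm.
set S := strong_attainable mu psi in clm nintm *.
have convS : convex_subset S.
  have [[i [j ij]]|Nle1] := pselect (exists i j : 'I_N, i != j).
    apply: (strong_attainable_convex mpsi psi0 psiK K0).
    exact: ratio_halving (hcont i) (hcont j) (hpos i) (hpos j) (hpsi i j ij).
  (* with at most one index, a partition has only the piece X *)
  have {}Nle1 (i j : 'I_N) : i = j.
    by apply: contrapT => /eqP ij; apply: Nle1; exists i, j.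
  have Suniq a b : S a -> S b -> a = b.
    have full A : \bigcup_(k : 'I_N) A k = [set: borel X] ->
        forall k, A k = setT.
      move=> AT k; rewrite -AT; apply/seteqP; split => [x kx|x [k' _]].
        by exists k.
      by rewrite (Nle1 k' k).
    move=> [A [_ /full AT _ Aa]] [B [_ /full BT _ Bb]]; apply/rowP => k.
    by apply: EFin_inj; rewrite -Aa -Bb AT BT.
  move=> a b Sa Sb _ [t _ <-].
  by rewrite (Suniq b a)// -scalerDl subrK scale1r.
have S0 : S !=set0.
  by have [s [Ss _]] := clm setT filterT; exists s.
have [l l0 lS] := support_hyperplane convS S0 nintm.
have [k0 lk0] : exists k, l ord0 k != 0.
  apply: contrapT => /forallNP lk; move/eqP: l0; apply.
  by apply/rowP => k; rewrite mxE; have /negP := lk k; rewrite negbK => /eqP.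
pose opt : 'rV[R]_N := optimum (T := borel X) psi l mu.
have optP : strong_partitions mu psi opt (cell (T := borel X) psi l).
  split.
  - by move=> i; exact: measurable_cell.
  - apply/seteqP; split => // x _.
    by have [i ix] := cell_cover (T := borel X) psi l k0 x; exists i.
  - move=> i j ij; rewrite (_ : _ `&` _ = set0) ?measure0//.
    apply/seteqP; split => // x [ix jx].
    by move/eqP: ij; apply; exact: cell_disjoint ix jx.
  - move=> i; rewrite (integral_psiE mu mpsi psi0 psiK) ?mxE//.
    exact: measurable_cell.
have lopt : dot l opt <= dot l m.
  by apply: lS; exists (cell (T := borel X) psi l).
(* strong partitions with moments near m have small deficit: l.opt <= l.m *)
have approx dl e : 0 < dl -> 0 < e ->
    exists nu : 'I_N -> {measure set (borel X) -> \bar R},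
    [/\ splitting mu nu,
        dot l opt - dot l (moment (T := borel X) psi nu) <= dl &
      forall i, `|m ord0 i - moment (T := borel X) psi nu ord0 i| < e].
  move=> dl0 e0; pose L := \sum_i `|l ord0 i| + 1.
  have L0 : 0 < L by rewrite ltr_wpDl// sumr_ge0.
  pose r := Num.min e (dl / L).
  have r0 : 0 < r by rewrite lt_min e0 divr_gt0.
  have [s [[A AP] [_ ms]]] := clm _ (nbhsx_ballx m r r0).
  have {}ms i : `|m ord0 i - s ord0 i| < r by exact: (ms ord0 i).
  have [nu [nuw _]] := strong_partition_weak mpsi psi0 AP.
  exists nu; rewrite (weak_partition_moment nuw); split.
  - exact: nuw.1.
  - apply: (@le_trans _ _ (dot l m - dot l s)); first by rewrite lerD2r.
    rewrite -dotB; apply: le_trans (ler_norm _) _.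
    apply: le_trans (ler_norm_sum _ _ _) _.
    apply: (@le_trans _ _ (\sum_i `|l ord0 i| * r)).
      apply: ler_sum => i _; rewrite normrM ler_wpM2l// !mxE ltW//.
    rewrite -mulr_suml; apply: (@le_trans _ _ (L * r)).
      by rewrite ler_wpM2r ?ltW// /L ltrDl.
    by rewrite mulrC -ler_pdivlMr// /r ge_min lexx orbT.
  - by move=> i; apply: lt_le_trans (ms i) _; rewrite /r ge_min lexx.
have NK0 : 0 < N%:R * K + 1 :> R by rewrite ltr_wpDl// mulr_ge0.
(* an index that is beaten everywhere would receive mass 0, but m_j > 0 *)
have unbeaten j k :
    ~ (forall x, weighted (T := borel X) psi l j x <
                 weighted (T := borel X) psi l k x).
  (* e is chosen so that the bound N K e of [moment_small] is below m_j / 2 *)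
  move=> jk; pose e := m ord0 j / 2 / (N%:R * K + 1).
  have e0 : 0 < e by rewrite !divr_gt0.
  have [i j' ->|dl dl0 H] := @leak_uniform _ (borel X) _ _ _ _
      mpsi psi0 psiK l mu (fun i j' => j' = j) e _ e0.
    rewrite /null_tie (_ : _ `&` _ = set0) ?measure0//.
    apply/seteqP; split => // x [[+ _] /=] eqx.
    by move=> /(_ k); rewrite eqx leNgt jk.
  have mj2 : 0 < m ord0 j / 2 by rewrite divr_gt0.
  have [nu [nus def close]] := approx dl (m ord0 j / 2) dl0 mj2.
  have := moment_small mpsi psi0 psiK K0 nus (fun i => H nu nus def i j erefl).
  have := close j; rewrite ltr_norml => /andP[_].
  have : N%:R * (K * e) <= m ord0 j / 2.
    rewrite mulrA /e mulrCA ler_piMr ?(ltW mj2)// ler_pdivrMr// mul1r.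
    by rewrite lerDl.
  lra.
have lne0 j : l ord0 j != 0.
  apply/negP => /eqP lj0.
  have [lk|lk|lk] := ltgtP (l ord0 k0) 0; last by rewrite lk eqxx in lk0.
  - apply: (@unbeaten k0 j) => x; rewrite /weighted lj0 mul0r.
    by rewrite nmulr_rlt0.
  - apply: (@unbeaten j k0) => x; rewrite /weighted lj0 mul0r.
    by rewrite mulr_gt0.
have tie i j : i != j -> null_tie (T := borel X) psi l mu i j.
  move=> ij; apply/eqP; rewrite eq_le measure_ge0 andbT.
  have lij : 0 < l ord0 i ^+ 2 + (- l ord0 j) ^+ 2.
    by rewrite ltr_pwDl ?sqr_ge0// exprn_even_gt0//= lne0.
  rewrite -(hpsi i j ij (l ord0 i) (- l ord0 j) lij).
  apply: le_measure; rewrite ?inE.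
  - apply: measurableI; first exact: measurable_cell.
    exact: measurable_eq_set (measurable_weighted mpsi l i)
      (measurable_weighted mpsi l j).
  - apply: (measurable_eq_set (T := borel X)); last exact: measurable_cst.
    by apply: measurable_funD; apply: measurable_funM => //;
      exact: measurable_cst.
  - by move=> x [_ /=]; rewrite /weighted mulNr => ->; rewrite subrr.
have mopt : m = opt.
  apply/rowP => j; apply/eqP; rewrite -subr_eq0 -normr_le0.
  apply/ler_addgt0Pl => e e0; rewrite addr0.
  pose e' := e / 2 / (N%:R * K + 1).
  have e2 : 0 < e / 2 by rewrite divr_gt0.
  have e'0 : 0 < e' by rewrite divr_gt0.
  have [dl dl0 H] := @leak_uniform _ (borel X) _ _ _ _
      mpsi psi0 psiK l mu (fun i j => i != j) e' tie e'0.
  have [nu [nus def close]] := approx dl (e / 2) dl0 e2.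
  have near_opt :=
    moment_close mpsi psi0 psiK K0 nus (ltW e'0) (H nu nus def) j.
  apply: le_trans (ler_distD (moment (T := borel X) psi nu ord0 j) _ _) _.
  rewrite [e]splitr; apply: lerD; first exact/ltW/close.
  apply: le_trans near_opt _.
  rewrite mulrA /e' mulrCA ler_piMr ?(ltW e2)// ler_pdivrMr// mul1r.
  by rewrite lerDl.
have rigid := rigidity mpsi psi0 psiK K0 tie.
have Sm : S m by rewrite mopt; exists (cell (T := borel X) psi l).
split.
  split=> // a b ab abS [t /andP[t0 t1] mE]; apply: ab.
  have Sa : S a.
    apply: abS; exists 0; first by rewrite /= lexx ler01.
    by rewrite subr0 scale1r scale0r addr0.
  have Sb : S b.
    apply: abS; exists 1; first by rewrite /= lexx ler01.
    by rewrite subrr scale1r scale0r add0r.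
  have := lS _ Sa; have := lS _ Sb.
  have : dot l m = (1 - t) * dot l a + t * dot l b by rewrite -mE dotD !dotZ.
  move=> lm lb la.
  have top s : S s -> dot l m <= dot l s -> s = m.
    move=> [A AP] ls; have [nu [nuw _]] := strong_partition_weak mpsi psi0 AP.
    have nus := weak_partition_moment nuw.
    have [|optE _] := rigid nu nuw.1; first by rewrite nus -/opt -mopt.
    by rewrite -nus optE mopt.
  have [ma mb] := mean_upper_bounds t0 t1 lm la lb.
  by rewrite (top a Sa ma) (top b Sb mb).
have [nu [nuw nuE]] := strong_partition_weak mpsi psi0 optP.
have nuP nu' : weak_partitions mu psi m nu' ->
    forall j B, measurable B ->
      nu' j B = mu (B `&` cell (T := borel X) psi l j).
  move=> nuw'; have [|//] := rigid nu' nuw'.1.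
  by rewrite (weak_partition_moment nuw') mopt.
exists nu; split; first by rewrite mopt.
- by move=> nu' nuw' i B mB; rewrite (nuP nu' nuw') ?nuE.
- by exists (cell (T := borel X) psi l) => //; rewrite mopt.
Qed.
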